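(* Let $t_{i,j}$ be the coefficient of $x^iy^j$ in the Tutte polynomial of $L$. Then for each $1\le k\le n-1$, $$\sum_{i=0}^{k}(-1)^i\sum_{u=0}^{r-k+i}\binom{r-u}{k-i}\,t_{u,n-r-i}=0.$$
   Context: $L$ is a complex vector space of dimension $r$ equipped with linear forms $\ell_1,\dots,\ell_n\in L^*$ (possibly zero, possibly proportional) whose common zero locus is $0$. For $A\subseteq E=\{1,\dots,n\}$ let $\operatorname{rk}(A)$ be the dimension of the span of $\{\ell_i\}_{i\in A}$. The Tutte polynomial of $L$ is $T_L(x,y)=\sum_{A\subseteq E}(x-1)^{r-\operatorname{rk}(A)}(y-1)^{|A|-\operatorname{rk}(A)}$. Conventions: $t_{u,v}=0$ if $v<0$, and a sum over an empty range is $0$. *)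

(* Defs.v *)
(* Mathematical Components world. *)
From HB Require Import structures.
From mathcomp Require Import all_boot all_order all_algebra.
From mathcomp Require Import reals.
From mathcomp Require Export complex.
Set Implicit Arguments.
Unset Strict Implicit.
Unset Printing Implicit Defensive.

Import GRing.Theory Num.Theory.

Local Open Scope ring_scope.
Local Open Scope complex_scope.

Section Tutte.

Variables (R : realType) (L : vectType R[i]) (n : nat).
Variable ell : 'I_n -> 'Hom(L, R[i]^o).

Definition rk (A : {set 'I_n}) : nat := \dim <<[seq ell i | i in A]>>%VS.

(* In {poly {poly int}} the outer indeterminate ['X] is x and the inner one,
   ['Y] (notation of polyXY for ['X%:P]), is y.
   The subtractions in the exponents are on nat; they do not truncate, as
   rk A <= \dim L always and rk A <= #|A|. *)
Definition tutte : {poly {poly int}} :=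
  \sum_(A : {set 'I_n})
    ('X - 1) ^+ (\dim {:L} - rk A) * ('Y - 1) ^+ (#|A| - rk A).

(* Coefficient of x^u y^v, extended by 0 to negative v. *)
Definition tcoef (u : nat) (v : int) : int :=
  if v is Posz j then tutte`_u`_j else 0.

End Tutte.

(* Main.v *)
(* On the hyperbola (x - 1) (y - 1) = 1 every subset A contributes
   (x - 1)^r (y - 1)^|A| to the Tutte polynomial.  Clearing denominators
   after x = y / (y - 1) gives
     \sum_(u, v) t_(u, v) y^(u + v) (y - 1)^(r - u) = y^n.
   As rk E = r, the nullity never exceeds n - r, so only v = n - r - i with
   i >= 0 occur, and the identity is the vanishing of the coefficient of y^(n - k). *)
Require Import Defs.
From mathcomp Require Import all_boot all_order all_algebra.
From mathcomp Require Import reals.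
From mathcomp Require Import zify ring.
Import GRing.Theory Num.Theory.
Local Open Scope ring_scope.
Local Open Scope complex_scope.

(* t^m P(s / t), provided [size P <= m.+1]; higher coefficients are dropped. *)
Definition homog {A : comNzRingType} (s t : A) (m : nat) (P : {poly A}) : A :=
  \sum_(u < m.+1) P`_u * s ^+ u * t ^+ (m - u).

Lemma homog_sum {A : comNzRingType} (s t : A) (m : nat) (I : finType)
    (F : I -> {poly A}) :
  homog s t m (\sum_i F i) = \sum_i homog s t m (F i).
Proof.
rewrite /homog exchange_big; apply: eq_bigr => u _ /=.
by rewrite coef_sum !mulr_suml.
Qed.

Lemma homogMC {A : comNzRingType} (s t : A) (m : nat) (P : {poly A}) (c : A) :
  homog s t m (P * c%:P) = homog s t m P * c.
Proof.
rewrite /homog mulr_suml; apply: eq_bigr => u _.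
by rewrite coefMC; ring.
Qed.

Lemma homog1 {A : comNzRingType} (s t : A) (m : nat) :
  homog s t m 1 = t ^+ m.
Proof.
rewrite /homog big_ord_recl big1 => [|u _]; last by rewrite coef1 !mul0r.
by rewrite coef1 expr0 !mul1r addr0 subn0.
Qed.

(** At [s / t] the factor ['X - 1] becomes [(s - t) / t]. The size bound excludes a term of [P] of
    degree [m.+1], which [homog s t m.+1] would keep but [homog s t m] drops. *)
Lemma homogXsub1 {A : comNzRingType} (s t : A) (m : nat) (P : {poly A}) :
  (size P <= m.+1)%N ->
  homog s t m.+1 (('X - 1) * P) = (s - t) * homog s t m P.
Proof.
move=> sP; rewrite mulrBl mulrBl mul1r /homog.
under eq_bigr do rewrite coefB !mulrBl.
rewrite sumrB; congr (_ - _).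
  rewrite big_ord_recl coefXM !mul0r add0r mulr_sumr.
  apply: eq_bigr => u _; rewrite coefXM lift0 subSS exprS /=; ring.
rewrite big_ord_recr /= [P`_m.+1]nth_default // !mul0r addr0 mulr_sumr.
apply: eq_bigr => u _; rewrite subSn -1?ltnS // exprS; ring.
Qed.

Lemma homog_Xsub1_exp {A : comNzRingType} (s t : A) (m a : nat) :
  (a <= m)%N -> homog s t m (('X - 1) ^+ a) = (s - t) ^+ a * t ^+ (m - a).
Proof.
elim: a m => [|a IHa] [|m] // am; rewrite ?homog1 ?mul1r //.
rewrite exprS homogXsub1 ?IHa 1?exprS ?mulrA //.
by rewrite -polyC1 size_exp_XsubC.
Qed.

(** Each further form cuts the dimension by at most one, its image being at most a line. *)
Lemma dim_bigcap_lker (K : fieldType) (V : vectType K)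
    (s : seq 'Hom(V, K^o)) :
  (\dim {:V} <= \dim (\bigcap_(f <- s) lker f) + size s)%N.
Proof.
elim: s => [|f s IHs]; first by rewrite big_nil addn0.
rewrite big_cons capvC /= addnS -addSn; apply: leq_trans IHs _.
rewrite leq_add2r -(limg_ker_dim f) -addn1 leq_add2l.
by apply: leq_trans (dimvS (subvf _)) _; rewrite dimvf.
Qed.

(** A basis of the span has the same common kernel as [s], namely 0, so it has at least [\dim {:V}]
    elements; the dimension of the dual gives the other bound. *)
Lemma dim_span_separating (K : fieldType) (V : vectType K)
    (s : seq 'Hom(V, K^o)) :
  (forall v, (forall f, f \in s -> f v = 0) -> v = 0) ->
  \dim <<s>>%VS = \dim {:V}.
Proof.
move=> sep; apply/eqP; rewrite eqn_leq; apply/andP; split.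
  by apply: leq_trans (dimvS (subvf _)) _; rewrite !dimvf /= /dim /= muln1.
have := dim_bigcap_lker K V (vbasis <<s>>).
rewrite size_tuple; suff -> : (\bigcap_(f <- vbasis <<s>>) lker f = 0)%VS.
  by rewrite dimv0.
apply/eqP; rewrite -subv0; apply/subvP => v.
rewrite memv0 => kv; apply/eqP/sep => f fs.
rewrite (coord_vbasis (memv_span fs)) sum_lfunE big1 // => j _.
rewrite scale_lfunE.
suff /eqP -> : (vbasis <<s>>)`_j v == 0 by rewrite scaler0.
rewrite -memv_ker; apply: subvP kv.
by rewrite (big_rem (vbasis <<s>>)`_j) ?capvSl //= mem_nth ?size_tuple.
Qed.

Lemma coefX_Xsub1_exp (A : comNzRingType) (a b k : nat) : (k <= a + b)%N ->
  ('X^a * ('X - 1) ^+ b : {poly A})`_(a + b - k) = (-1) ^+ k *+ 'C(b, k).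
Proof.
move=> kab; rewrite coefXnM.
have [kb|bk] := leqP k b; last first.
  by rewrite bin_small // mulr0n ifT //; lia.
rewrite ifF; last by lia.
have -> : (a + b - k - a = b - k)%N by lia.
rewrite exprBn coef_sum (bigD1 (Ordinal (kb : (k < b.+1)%N))) //= big1 => [|i].
  rewrite addr0 expr1n mulr1 coefMn -(rmorph_sign polyC) coefCM coefXn.
  by rewrite eqxx mulr1.
rewrite -val_eqE /= => ik.
rewrite expr1n mulr1 coefMn -(rmorph_sign polyC) coefCM coefXn.
have := ltn_ord i; case: eqP => [|_ _]; first by lia.
by rewrite mulr0 mul0rn.
Qed.

(* [m + a + b] bounds the degree, so for [k < i] the coefficient [q`_(m - i)]
   cannot contribute. *)
Lemma coefM_Xsub1_exp (A : comNzRingType) (q : {poly A}) (m a b k : nat) :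
  (size q <= m.+1)%N -> (k <= m + a + b)%N ->
  (q * 'X^a * ('X - 1) ^+ b)`_(m + a + b - k) =
  \sum_(i < k.+1 | (i <= m)%N) q`_(m - i) * ((-1) ^+ (k - i) *+ 'C(b, k - i)).
Proof.
move=> sq km.
have {1}-> : q = \sum_(i < m.+1) (q`_(m - i))%:P * 'X^(m - i).
  apply/polyP => j; rewrite coef_sum.
  under eq_bigr do rewrite coefCM coefXn.
  have [jm|mj] := leqP j m; last first.
    rewrite nth_default ?(leq_trans sq) // big1 // => i _.
    by case: eqP => [|_]; [lia | rewrite mulr0].
  rewrite (bigD1 (rev_ord (Ordinal (jm : (j < m.+1)%N)))) //= big1 => [|i].
    by rewrite subSS subKn // eqxx mulr1 addr0.
  rewrite -val_eqE /= => ij; have := ltn_ord i.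
  by case: eqP => [|_ _]; [lia | rewrite mulr0].
rewrite !mulr_suml coef_sum.
transitivity (\sum_(i < m.+1 | (i <= k)%N)
    q`_(m - i) * ((-1) ^+ (k - i) *+ 'C(b, k - i))).
  rewrite [RHS]big_mkcond; apply: eq_bigr => i _ /=; have im := ltn_ord i.
  rewrite -!mulrA coefCM mulrA -exprD; case: leqP => [ik|ki].
    rewrite -(coefX_Xsub1_exp A (m - i + a)); last by lia.
    by congr (_ * _`_ _); lia.
  rewrite [_`_(m + a + b - k)]nth_default ?mulr0 //.
  apply: leq_trans (size_polyMleq _ _) _.
  rewrite size_polyXn -polyC1 size_exp_XsubC; lia.
pose F i := q`_(m - i) * ((-1) ^+ (k - i) *+ 'C(b, k - i)).
(* Both sums run over [i <= k] and [i <= m]; widening each to the common range [i <= m + k] makes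
   them comparable. *)
rewrite -(big_mkord (fun i => i <= k)%N F) -(big_mkord (fun i => i <= m)%N F).
rewrite (big_nat_widen _ _ (m + k).+1) ?ltnS ?leq_addr //.
rewrite [RHS](big_nat_widen _ _ (m + k).+1) ?ltnS ?leq_addl //.
by apply: eq_bigl => i; rewrite /= !ltnS andbC.
Qed.

(** Expand the product of [n] factors [z + 1]; [B] collects the factors that contribute [z]. *)
Lemma sum_exp_card (A : comNzRingType) (n : nat) (z : A) :
  \sum_(B : {set 'I_n}) z ^+ #|B| = (z + 1) ^+ n.
Proof.
have := @bigA_distr A 0 1 *%R +%R 'I_n (fun=> z) (fun=> 1).
rewrite prodr_const card_ord => ->; apply: eq_bigr => B _.
by rewrite -big_mkcond prodr_const.
Qed.

Section TutteVector.
Variables (R : realType) (L : vectType R[i]) (n : nat).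
Variable ell : 'I_n -> 'Hom(L, R[i]^o).
Implicit Type A : {set 'I_n}.

Lemma rk_le_dim A : (rk ell A <= \dim {:L})%N.
Proof.
by apply: leq_trans (dimvS (subvf _)) _; rewrite !dimvf /= /dim /= muln1.
Qed.

Lemma rk_le_card A : (rk ell A <= #|A|)%N.
Proof. by apply: leq_trans (dim_span _) _; rewrite size_map -cardE. Qed.

(** Each index outside [A] raises the rank by at most one. *)
Lemma nullity_le A : (#|A| - rk ell A <= n - rk ell setT)%N.
Proof.
have: (rk ell setT <= rk ell A + #|~: A|)%N.
  apply: leq_trans (leq_add (leqnn _) (rk_le_card (~: A))).
  apply: leq_trans (dimv_add_leqif _ _); rewrite -span_cat; apply: dimvS.
  apply/sub_span => f /mapP[i _ ->]; rewrite mem_cat.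
  case: (boolP (i \in A)) => iA; apply/orP; [left | right];
    by rewrite map_f // mem_enum // inE.
by have := cardsC A; have := rk_le_card A; rewrite card_ord; lia.
Qed.

(** Here ['X] is y. Since [s - t = 1], the summand of [A] becomes
    [t ^+ rk A * t ^+ (#|A| - rk A)]. *)
Lemma homog_tutte : homog 'X ('X - 1) (\dim {:L}) (tutte ell) = 'X^n.
Proof.
rewrite /tutte homog_sum -[X in X ^+ n](subrK 1) -sum_exp_card.
apply: eq_bigr => A _.
rewrite -polyC1 -polyCB -polyC_exp homogMC homog_Xsub1_exp ?leq_subr //.
rewrite subKr expr1n mul1r subKn ?rk_le_dim // -exprD.
by rewrite subnKC ?rk_le_card.
Qed.

Lemma size_coef_tutte u : (size ((tutte ell)`_u)%R <= (n - rk ell setT).+1)%N.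
Proof.
rewrite coef_sum; apply: leq_trans (size_sum _ _ _) _.
apply/bigmax_leqP => A _.
rewrite -['Y - 1](rmorphB polyC) -rmorphXn coefMC.
(* The factor in x has integer coefficients, so it only scales the power of y - 1. *)
have -> : ('X - 1 : {poly {poly int}}) = map_poly polyC ('X - 1).
  by rewrite rmorphB rmorph1 /= map_polyX.
rewrite -rmorphXn coef_map /= mul_polyC.
apply: leq_trans (size_scale_leq _ _) _.
by rewrite -polyC1 size_exp_XsubC ltnS nullity_le.
Qed.

Lemma rk_setT : (forall v : L, (forall i : 'I_n, ell i v = 0) -> v = 0) ->
  rk ell setT = \dim {:L}.
Proof.
move=> sep; apply: dim_span_separating => v sv; apply: sep => i.
by apply/sv/map_f; rewrite mem_enum inE.
Qed.

End TutteVector.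

(* The range 0 <= u < (r + i).+1 - k is 0 <= u <= r - k + i, and is empty when
   r - k + i < 0; the second index of tcoef is an integer, possibly negative. *)
Theorem proposition5p7 (R : realType) (L : vectType R[i]) (n r : nat)
    (ell : 'I_n -> 'Hom(L, R[i]^o))
    (hr : \dim {:L} = r)
    (hell : forall v : L, (forall i : 'I_n, ell i v = 0) -> v = 0)
    (k : nat) (hk : (1 <= k <= n - 1)%N) :
  \sum_(0 <= i < k.+1) (-1) ^+ i *
    (\sum_(0 <= u < (r + i).+1 - k)
       'C(r - u, k - i)%:Z * tcoef ell u (n%:Z - r%:Z - i%:Z)) = 0.
Proof.
have rkE : rk ell setT = r by rewrite rk_setT.
have rn : (r <= n)%N by rewrite -rkE -[leqRHS]card_ord -cardsT rk_le_card.
have := congr1 (fun p : {poly int} => p`_(n - k)) (homog_tutte R L n ell).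
rewrite coefXn hr (_ : (n - k == n)%N = false); last by lia.
rewrite coef_sum => sum0.
have {sum0} : \sum_(u < r.+1) \sum_(i < k.+1 | (i <= n - r)%N)
    (tutte ell)`_u`_(n - r - i) *
      ((-1) ^+ (k - i) *+ 'C(r - u, k - i)) = 0.
  rewrite -[RHS]sum0; apply: eq_bigr => u _; have ur := ltn_ord u.
  (* The summand at [u] has degree at most [n] in y, whatever [u] is. *)
  have -> : (n - k = (n - r) + u + (r - u) - k)%N by lia.
  rewrite coefM_Xsub1_exp //; last by lia.
  by have := size_coef_tutte R L n ell u; rewrite rkE.
(* Multiplying by [(-1) ^+ k] turns the sign [(-1) ^+ i] into [(-1) ^+ (k - i)]. *)
move=> sum0; apply: (@lreg_sign int k); rewrite mulr0 -[RHS]sum0.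
rewrite exchange_big [RHS]big_mkcond big_mkord mulr_sumr.
apply: eq_bigr => i _; have ik := ltn_ord i.
case: leqP => [inr|nri]; last first.
  rewrite (_ : n%:Z - r%:Z - i%:Z = Negz (i - (n - r)).-1); last by lia.
  by rewrite big1 ?mulr0 // => u _; rewrite mulr0.
have -> : n%:Z - r%:Z - i%:Z = (n - r - i)%N by lia.
(* The terms added up to [u = r] vanish: there [r - u < k - i], so the binomial is 0. *)
rewrite (big_nat_widen _ _ r.+1); last by lia.
rewrite big_mkord big_mkcond mulr_sumr mulr_sumr; apply: eq_bigr => u _ /=.
rewrite mulrA -exprD; case: ltnP => uk; last first.
  by rewrite bin_small ?mulr0n ?mulr0 //; have := ltn_ord u; lia.
have -> : (-1) ^+ (k + i) = (-1) ^+ (k - i) :> int.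
  by rewrite -[LHS]signr_odd -[RHS]signr_odd oddD oddB.
by rewrite -mulr_natr natz; ring.
Qed.
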